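(* For every unsatisfiable clause-set $F$ and every $k\in\mathbb{N}_0$: $\mathrm{whd}(F)>k$ if and only if there exists a $k$-consistent set of partial assignments for $F$.
   Context: Literals are variables $v$ or negations $\overline{v}$; clauses are finite sets of literals without complementary pair; clause-sets are finite sets of clauses; $\bot$ is the empty clause; $\mathrm{var}(F)$ is the set of variables of $F$. A partial assignment $\varphi$ maps a finite variable set $\mathrm{var}(\varphi)$ to $\{0,1\}$, $n(\varphi)=|\mathrm{var}(\varphi)|$, $\langle v\to\varepsilon\rangle$ is the assignment setting only $v$ to $\varepsilon$; $\varphi*F$ removes satisfied clauses and false literals. $F$ is unsatisfiable if no $\varphi$ yields $\varphi*F=\emptyset$. Resolution: clauses $C,D$ with exactly one clashing literal $x\in C$, $\overline{x}\in D$ have resolvent $(C\cup D)\setminus\{x,\overline{x}\}$. A resolution tree is a finite rooted tree, each inner node having exactly two children, nodes labelled by clauses, each inner label the resolvent of its children's labels; a refutation of $F$ has leaf labels in $F$ and root label $\bot$. Asymmetric width of a resolution tree $T$: $\mathrm{whd}(T)=0$ if $T$ is a single node; otherwise, with children $w_1,w_2$ of the root labelled $C_1,C_2$ and subtrees $T_1,T_2$, $\mathrm{whd}(T)=\max(\mathrm{whd}(T_1),\mathrm{whd}(T_2),\min(|C_1|,|C_2|))$. For unsatisfiable $F$, $\mathrm{whd}(F)$ is the minimum of $\mathrm{whd}(T)$ over refutations $T$ of $F$. A set $\mathbb{P}$ of partial assignments is minimally consistent for $F$ if $\mathbb{P}\neq\emptyset$, every $\varphi\in\mathbb{P}$ has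 $\mathrm{var}(\varphi)\subseteq\mathrm{var}(F)$, and $\bot\notin\varphi*F$ for every $\varphi\in\mathbb{P}$. It is $k$-consistent for $F$ if it is minimally consistent and for all $\varphi\in\mathbb{P}$, all $v\in\mathrm{var}(F)\setminus\mathrm{var}(\varphi)$, all $\psi\subseteq\varphi$ with $n(\psi)<k$ and both $\varepsilon\in\{0,1\}$ there is $\varphi'\in\mathbb{P}$ with $\psi\cup\langle v\to\varepsilon\rangle\subseteq\varphi'$. *)

(* Defs.v *)
From HB Require Import structures.
From mathcomp Require Import all_boot all_order.
From mathcomp Require Import finmap.
From mathcomp Require Import boolp classical_sets.

Set Implicit Arguments.
Unset Strict Implicit.
Unset Printing Implicit Defensive.

Local Open Scope fset_scope.
Local Open Scope fmap_scope.

(* [(v, true)] is the positive literal v, [(v, false)] its negation. *)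
Notation literal V := (V * bool)%type.

Definition compl (V : choiceType) (x : literal V) : literal V := (x.1, ~~ x.2).

Definition clash_free (V : choiceType) (C : {fset literal V}) : bool :=
  [forall x : C, compl (val x) \notin C].

Record clause (V : choiceType) :=
  Clause { lits :> {fset literal V}; _ : clash_free lits }.

HB.instance Definition _ (V : choiceType) := [isSub for @lits V].
HB.instance Definition _ (V : choiceType) := [Choice of clause V by <:].

Lemma clash_free0 (V : choiceType) : clash_free (fset0 : {fset literal V}).
Proof. by apply/forallP => -[x xP]. Qed.

Lemma clash_freeS (V : choiceType) (C D : {fset literal V}) :
  D `<=` C -> clash_free C -> clash_free D.
Proof.
move=> /fsubsetP sDC /forallP CP; apply/forallP => -[x xD] /=.
by apply: contra (CP [` sDC _ xD]) => /sDC.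
Qed.

Definition bot (V : choiceType) : clause V := Clause (clash_free0 V).

Notation clause_set V := {fset clause V}.

Definition var_clause (V : choiceType) (C : clause V) : {fset V} :=
  [fset x.1 | x in lits C].

Definition var (V : choiceType) (F : clause_set V) : {fset V} :=
  \bigcup_(C <- F) var_clause C.

Notation passign V := {fmap V -> bool}.

Section Assignments.
Variable V : choiceType.
Implicit Types (phi psi : passign V) (x : literal V) (C : clause V).
Implicit Types (F : clause_set V).

Definition lit_true phi x : bool := phi.[? x.1] == Some x.2.

Definition lit_false phi x : bool := phi.[? x.1] == Some (~~ x.2).

Definition satisfied phi C : bool := [exists x : lits C, lit_true phi (val x)].

Definition remove_false phi C : clause V :=
  Clause (clash_freeS (fset_sub _ _ : [fset x in lits C | ~~ lit_false phi x] `<=` C)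
                      (valP C)).

Definition apply_assign phi F : clause_set V :=
  [fset remove_false phi C | C in F & ~~ satisfied phi C].

Definition unsatisfiable F : Prop := forall phi, apply_assign phi F <> fset0.

Definition size_assign phi : nat := #|` domf phi|.

Definition sub_assign psi phi : Prop :=
  forall v b, psi.[? v] = Some b -> phi.[? v] = Some b.

Definition minimally_consistent F (P : set (passign V)) : Prop :=
  [/\ (P !=set0)%classic,
      forall phi, P phi -> domf phi `<=` var F
    & forall phi, P phi -> bot V \notin apply_assign phi F].

(* As v is not in the domain of phi, hence not in that of psi, the update
   [psi.[v <- eps]] is the union of psi and the assignment v -> eps. *)
Definition consistent (k : nat) F (P : set (passign V)) : Prop :=
  minimally_consistent F P /\
  forall phi, P phi ->
  forall v, v \in var F `\` domf phi ->
  forall psi, sub_assign psi phi -> size_assign psi < k ->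
  forall eps : bool,
  exists2 phi', P phi' & sub_assign psi.[v <- eps] phi'.

End Assignments.

Section Resolution.
Variable V : choiceType.
Implicit Types (C D R : clause V) (F : clause_set V).

Definition clashing C D : {fset literal V} := [fset x in lits C | compl x \in lits D].

Definition resolvent C D R : Prop :=
  exists2 x, clashing C D = [fset x]
           & lits R = (lits C `|` lits D) `\` [fset x; compl x].

Inductive tree : Type :=
| Leaf of clause V
| Node of clause V & tree & tree.

Definition label (T : tree) : clause V :=
  match T with Leaf C => C | Node C _ _ => C end.

Fixpoint resolution_tree (T : tree) : Prop :=
  match T with
  | Leaf _ => True
  | Node C T1 T2 =>
      [/\ resolvent (label T1) (label T2) C, resolution_tree T1
        & resolution_tree T2]
  end.

Fixpoint leaves_in F (T : tree) : Prop :=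
  match T with
  | Leaf C => C \in F
  | Node _ T1 T2 => leaves_in F T1 /\ leaves_in F T2
  end.

Definition refutation F (T : tree) : Prop :=
  [/\ resolution_tree T, leaves_in F T & label T = bot V].

Fixpoint whd_tree (T : tree) : nat :=
  match T with
  | Leaf _ => 0
  | Node _ T1 T2 =>
      maxn (maxn (whd_tree T1) (whd_tree T2))
           (minn #|` lits (label T1)| #|` lits (label T2)|)
  end.

Definition refutable_at F (n : nat) : bool :=
  `[< exists2 T, refutation F T & whd_tree T = n >].

(* The minimum of [whd_tree] over all refutations; the value 0 is a dummy,
   taken only when F has no refutation, i.e. when F is satisfiable. *)
Definition whd F : nat :=
  match pselect (exists n, refutable_at F n) with
  | left ex => ex_minn ex
  | right _ => 0
  end.

End Resolution.

(* Main.v *)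
(** A narrow refutation is walked from the root upwards while maintaining an
    assignment of the consistent set that falsifies the current clause; when
    the resolution variable is unset, k-consistency is applied to the narrower
    premise.  Conversely, let D be the set of clauses having a tree of
    asymmetric width at most k.  The assignments falsifying no clause of D, and
    maximal with this property, form a k-consistent set: if setting v either
    way falsified clauses C1 and C2 of D, with C1 narrow, then their resolvent
    would be in D and already falsified.  For large k such a maximal assignment
    is total, which gives the completeness of resolution. *)
Require Import Defs.
From mathcomp Require Import all_boot all_order.
From mathcomp Require Import finmap.
From mathcomp Require Import boolp classical_sets.

Set Implicit Arguments.
Unset Strict Implicit.
Unset Printing Implicit Defensive.

Local Open Scope fset_scope.
Local Open Scope fmap_scope.

(** * Falsified clauses and their resolvents *)

Section Falsification.
Variable V : choiceType.
Implicit Types (phi psi : passign V) (x y : literal V) (C D R : clause V).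
Implicit Types (F : clause_set V).

Definition falsified phi C : Prop := forall x, x \in lits C -> lit_false phi x.

Lemma complK : involutive (@compl V).
Proof. by case=> v b; rewrite /compl /= negbK. Qed.

Lemma clause_compl C x : x \in lits C -> compl x \notin lits C.
Proof. by move=> xC; have /forallP/(_ [` xC]) := valP C. Qed.

Lemma lit_false_compl phi x : lit_false phi x -> ~~ lit_false phi (compl x).
Proof. by rewrite /lit_false => /eqP-> /=; case: x.2. Qed.

Lemma lit_false_sub psi phi x :
  sub_assign psi phi -> lit_false psi x -> lit_false phi x.
Proof. by rewrite /lit_false => s /eqP/s->. Qed.

Lemma falsified_sub psi phi C :
  sub_assign psi phi -> falsified psi C -> falsified phi C.
Proof. by move=> s f x /f; apply: lit_false_sub. Qed.

Lemma sub_assign_set phi v b :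
  v \notin domf phi -> sub_assign phi phi.[v <- b].
Proof.
move=> nv w c e; rewrite fnd_set; case: eqP => // wv.
by move: e; rewrite wv not_fnd.
Qed.

Lemma sub_assign_set2 psi phi v b :
  sub_assign psi phi -> sub_assign psi.[v <- b] phi.[v <- b].
Proof. by move=> s w c; rewrite !fnd_set; case: eqP => // _ /s. Qed.

Lemma sub_assign_dom psi phi : sub_assign psi phi -> domf psi `<=` domf phi.
Proof.
move=> s; apply/fsubsetP => v vpsi.
by have := s v _ (in_fnd vpsi); case: fndP.
Qed.

(** One assignment cannot falsify two distinct literals over the same variable, so sending a
    falsified literal to its variable is injective into [domf phi]. *)
Lemma falsified_size phi C : falsified phi C -> #|` lits C| <= size_assign phi.
Proof.
move=> fC; have inj : {in lits C &, injective (fun x : literal V => x.1)}.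
  move=> [v a] [w b] /fC/eqP /= ea /fC/eqP /= eb /= e.
  by move: ea; rewrite e eb => -[/negb_inj->].
rewrite -(card_in_imfset imfset_key inj) fsubset_leq_card //.
apply/fsubsetP => _ /imfsetP[x /fC/eqP e ->].
by move: e; case: fndP.
Qed.

Lemma lit_false_set phi v b y :
  lit_false phi.[v <- b] y -> y != (v, ~~ b) -> lit_false phi y.
Proof.
case: y => w c; rewrite /lit_false fnd_set /= xpair_eqE.
by case: (eqVneq w v) => //= _; case: b c => -[].
Qed.

Lemma falsified_set phi v b C :
  falsified phi.[v <- b] C -> ~ falsified phi C -> (v, ~~ b) \in lits C.
Proof.
move=> fb nf; apply/negP => nC; apply: nf => y yC.
apply: lit_false_set (fb y yC) _; apply/eqP => e.
by apply: nC; rewrite -e.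
Qed.

Lemma clash_free_false phi (S : {fset literal V}) :
  (forall x, x \in S -> lit_false phi x) -> clash_free S.
Proof.
move=> fS; apply/forallP => -[x xS] /=; apply/negP => /fS.
by apply/negP/lit_false_compl/fS.
Qed.

(** Setting [v] makes the difference for both clauses, so [C] contains [(v, ~~ b)] and [D] contains
    [(v, b)]. All remaining literals are false under [phi] already, which makes their union
    clash-free. *)
Lemma falsified_resolvent phi v b C D :
  ~ falsified phi C -> ~ falsified phi D ->
  falsified phi.[v <- b] C -> falsified phi.[v <- ~~ b] D ->
  exists2 R, resolvent C D R & falsified phi R.
Proof.
move=> nC nD fC fD; pose x := (v, ~~ b).
have xC : x \in lits C := falsified_set fC nC.
have xD : compl x \in lits D := falsified_set fD nD.
have fS y : y \in (lits C `|` lits D) `\` [fset x; compl x] -> lit_false phi y.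
  rewrite !inE negb_or => /andP[/andP[yx ycx]].
  by case/orP=> [/fC|/fD] /lit_false_set; apply.
exists (Clause (clash_free_false fS)) => //; exists x => //.
apply/fsetP => y; rewrite !inE; apply/andP/eqP => [[yC yD]|-> //].
(* A second clash [y] would leave both [y] and its complement false under [phi]. *)
apply: contrapT => /eqP yx; have := lit_false_set (fC _ yC) yx.
move=> /lit_false_compl/negP; apply; apply: lit_false_set (fD _ yD) _.
by apply: contra yx => /eqP e; rewrite -[y]complK e /compl /x /= negbK.
Qed.

Lemma bot_in_apply phi F :
  reflect (exists2 C, C \in F & falsified phi C) (bot V \in apply_assign phi F).
Proof.
apply: (iffP idP) => [/imfsetP[C /= /andP[CF _] /(congr1 (@lits V)) /= e]|].
  exists C => // x xC; apply: contrapT => /negP nx.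
  by have := in_fset0 x; rewrite e !inE xC nx.
case=> C CF fC; apply/imfsetP; exists C => /=.
  rewrite inE CF; apply/existsP => -[[x xC]] /=.
  by rewrite /lit_true; have /eqP-> := fC x xC; case: x.2.
apply/val_inj/fsetP => x /=; rewrite !inE; apply/esym/negP => /andP[/fC].
by move=> ->.
Qed.

Lemma var_in F C x : C \in F -> x \in lits C -> x.1 \in var F.
Proof.
move=> CF xC; apply/bigfcupP; exists C; first by rewrite CF.
exact: in_imfset.
Qed.

(** An assignment that is total on [var F] satisfies every clause it does not falsify, so without a
    falsified clause it would satisfy all of [F]. *)
Lemma total_bot_in_apply F phi : unsatisfiable F ->
  var F `<=` domf phi -> bot V \in apply_assign phi F.
Proof.
move=> uF /fsubsetP tot; apply/bot_in_apply; apply: contrapT => nb.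
apply: (uF phi); apply/fsetP => E; rewrite inE; apply/negP.
move=> /imfsetP[C /= /andP[CF /existsP nsat] _]; apply: nb; exists C => // x xC.
have xd := tot _ (var_in CF xC); apply: contrapT => nf; apply: nsat.
exists [` xC]; move: nf; rewrite /lit_true /lit_false /= (in_fnd xd).
by case: (phi _); case: x.2.
Qed.

Lemma resolvent_sym C D R : resolvent C D R -> resolvent D C R.
Proof.
case=> x cl eR; exists (compl x); last first.
  by rewrite eR fsetUC complK [X in _ `\` X]fsetUC.
apply/fsetP => y; have /fsetP/(_ (compl y)) := cl.
rewrite !inE complK andbC => ->.
by apply/eqP/eqP => [<-|->]; rewrite complK.
Qed.

Lemma resolventP C D R : resolvent C D R ->
  exists x, [/\ x \in lits C, compl x \in lits D,
    {in lits C, forall y, y != x -> y \in lits R}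
  & {in lits D, forall y, y != compl x -> y \in lits R}].
Proof.
case=> x cl eR; exists x.
have /andP[xC xD] : (x \in lits C) && (compl x \in lits D).
  by have := fset11 x; rewrite -cl !inE.
split=> // y yS ny; rewrite eR !inE yS ?orbT andbT negb_or ny ?andbT //=.
  by apply: contraTneq yS => ->; apply: clause_compl.
by apply: contraTneq yS => ->; rewrite -[x]complK; apply: clause_compl.
Qed.

End Falsification.

(** * From a consistent set to a lower bound on width *)

Section ConsistentToWidth.
Variables (V : choiceType) (F : clause_set V) (k : nat) (P : set (passign V)).
Hypothesis cP : consistent k F P.
Implicit Types (C D R : clause V) (phi : passign V) (T : tree V).

Lemma consistent_step C D R phi :
  resolvent C D R -> #|` lits C| <= k ->
  {in lits C, forall x, x.1 \in var F} -> P phi -> falsified phi R ->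
  exists2 phi', P phi' & falsified phi' C \/ falsified phi' D.
Proof.
move=> /resolventP[x [xC xD CR DR]] leC vC Pphi fR.
have [xd|xd] := boolP (x.1 \in domf phi).
  exists phi => //.
  have [fx|fx] := boolP (lit_false phi x); [left|right] => y yS.
    by have [->//|/CR/fR] := eqVneq y x; apply.
  have [->|/DR/fR] := eqVneq y (compl x); last exact.
  by move: fx; rewrite /lit_false /= (in_fnd xd); case: (phi _); case: x.2.
(* Only the part of [phi] that falsifies [C] without the pivot [x] is kept. Leaving out [x] gives
   the strict bound below [k], and consistency then allows [x] to be made false. *)
pose A := [fset y.1 | y in lits C `\ x]; pose psi := phi.[& A].
have spsi : sub_assign psi phi.
  by move=> v b; rewrite fnd_restrict; case: ifP.
have npsi : size_assign psi < k.
  apply: leq_trans leC; rewrite (cardfsD1 x) xC ltnS.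
  apply: (@leq_trans #|` A|); last exact: leq_imfset_card.
  apply/fsubset_leq_card/fsubsetP => v.
  by rewrite mem_restrictf => /andP[].
have xvar : x.1 \in var F `\` domf phi by rewrite inE xd vC.
have [phi' Pphi' sub] := cP.2 phi Pphi x.1 xvar psi spsi npsi (~~ x.2).
exists phi' => //; left => y yC; apply: lit_false_sub sub _.
rewrite /lit_false fnd_set.
have [->|yx] := eqVneq y x; first by rewrite eqxx.
(* A literal on the pivot variable other than [x] cannot occur: [phi] would falsify it while leaving
   that variable unset. *)
have yphi := fR _ (CR _ yC yx); case: (eqVneq y.1 x.1) => [e|_].
  by move: yphi; rewrite /lit_false e not_fnd.
rewrite fnd_restrict ifT //; apply/imfsetP; exists y => //=.
by rewrite !inE yx.
Qed.

Lemma label_var T : resolution_tree T -> leaves_in F T ->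
  {in lits (label T), forall x, x.1 \in var F}.
Proof.
elim: T => [C _ CF x|C T1 IH1 T2 IH2 [[z _ eC] r1 r2] [l1 l2] x] /=.
  exact: var_in.
by rewrite eC !inE => /andP[_ /orP[/(IH1 r1 l1)|/(IH2 r2 l2)]].
Qed.

(** The induction is over all [phi] in [P], since descending to a premise may replace the
    assignment. At a leaf, minimal consistency gives the contradiction. *)
Lemma not_falsified_label T phi : resolution_tree T -> leaves_in F T ->
  whd_tree T <= k -> P phi -> ~ falsified phi (label T).
Proof.
elim: T phi => [C phi _ CF _ Pphi fC|C T1 IH1 T2 IH2 phi].
  by case: cP => -[_ _ /(_ _ Pphi) /bot_in_apply nb] _; apply: nb; exists C.
case=> res r1 r2 [l1 l2] /=; rewrite !geq_max geq_min.
move=> /andP[/andP[w1 w2] small] Pphi fC.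
suff [phi' Pphi' [f|f]] : exists2 phi', P phi' &
    falsified phi' (label T1) \/ falsified phi' (label T2).
- exact: IH1 f.
- exact: IH2 f.
case/orP: small => small.
  exact: consistent_step res small (label_var r1 l1) Pphi fC.
have [phi' Pphi' f] :=
  consistent_step (resolvent_sym res) small (label_var r2 l2) Pphi fC.
by exists phi' => //; case: f; [right|left].
Qed.

Lemma consistent_lt_whd_tree T : refutation F T -> k < whd_tree T.
Proof.
move=> [rT lT eT]; rewrite ltnNge; apply/negP => le.
have [[[phi Pphi] _ _] _] := cP.
by apply: (not_falsified_label rT lT le Pphi); rewrite eT => x; rewrite inE.
Qed.

End ConsistentToWidth.

(** * From a lower bound on width to a consistent set *)

Section WidthToConsistent.
Variables (V : choiceType) (F : clause_set V) (k : nat).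
Implicit Types (C D R : clause V) (phi psi : passign V) (T : tree V).

Definition derivable C : Prop :=
  exists T, [/\ resolution_tree T, leaves_in F T, label T = C & whd_tree T <= k].

Definition unrefuted phi : Prop :=
  domf phi `<=` var F /\ forall C, derivable C -> ~ falsified phi C.

(** One-variable extensions capture maximality, because restricting an unrefuted assignment keeps it
    unrefuted. *)
Definition maximal_unrefuted phi : Prop :=
  unrefuted phi /\
  forall v b, v \in var F `\` domf phi -> ~ unrefuted phi.[v <- b].

Lemma derivable_leaf C : C \in F -> derivable C.
Proof. by move=> CF; exists (Leaf C). Qed.

Lemma derivable_resolvent C D R : derivable C -> derivable D ->
  #|` lits C| <= k -> resolvent C D R -> derivable R.
Proof.
move=> [T1 [r1 l1 e1 w1]] [T2 [r2 l2 e2 w2]] leC res.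
exists (Node R T1 T2); split=> //=; first by rewrite e1 e2.
by rewrite !geq_max w1 w2 geq_min e1 leC.
Qed.

(** Greedy extension terminates: each step lowers the number of unset variables of [F]. *)
Lemma unrefuted_extend phi : unrefuted phi ->
  exists2 phi', maximal_unrefuted phi' & sub_assign phi phi'.
Proof.
have [n] := ubnP #|` var F `\` domf phi|; elim: n phi => // n IH phi le uphi.
have [[v [b [vF ub]]]|no] := pselect
    (exists v b, v \in var F `\` domf phi /\ unrefuted phi.[v <- b]); last first.
  by exists phi => //; split=> // v b vF ub; apply: no; exists v, b.
have := vF; rewrite inE => /andP[vd _].
have [|phi' m s] := IH _ _ ub.
  move: le; rewrite (cardfsD1 v) vF ltnS; apply: leq_trans.
  rewrite add1n ltnS; apply: fsubset_leq_card; apply/fsubsetP => w.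
  by rewrite !inE negb_or -!andbA.
by exists phi' => // w c /(sub_assign_set b vd)/s.
Qed.

(** A derivable [C] falsified by [psi.[v <- b]] has at most [size_assign psi + 1 <= k] literals, so
    it can serve as the narrow premise. The clause [D] that blocks the opposite value of [v] may be
    arbitrarily wide. *)
Lemma maximal_unrefuted_set phi psi v b : maximal_unrefuted phi ->
  v \in var F `\` domf phi -> sub_assign psi phi -> size_assign psi < k ->
  unrefuted psi.[v <- b].
Proof.
move=> [[dphi uphi] mphi] vF spsi npsi.
have := vF; rewrite inE => /andP[vd vvar].
have dset phi' c : domf phi' `<=` var F -> domf phi'.[v <- c] `<=` var F.
  by rewrite dom_setf => d; rewrite fsubUset fsub1set vvar.
split=> [|C dC fC]; first exact/dset/(fsubset_trans _ dphi)/sub_assign_dom.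
have leC : #|` lits C| <= k.
  apply: leq_trans (falsified_size fC) (leq_trans _ npsi).
  rewrite /size_assign dom_setf cardfsU1.
  by case: (_ \notin _) => //; rewrite leqW.
apply: (mphi v (~~ b) vF); split=> [|D dD fD]; first exact: dset.
have fC' := falsified_sub (sub_assign_set2 spsi) fC.
have [R res fR] := falsified_resolvent (uphi C dC) (uphi D dD) fC' fD.
exact: uphi (derivable_resolvent dC dD leC res) fR.
Qed.

Hypothesis bot_underivable : ~ derivable (bot V).

Lemma exists_maximal_unrefuted : exists phi, maximal_unrefuted phi.
Proof.
suff /unrefuted_extend[phi m _] : unrefuted [fmap] by exists phi.
(* The empty assignment falsifies only the empty clause. *)
split=> [|C dC fC]; first by rewrite fsub0set.
apply: bot_underivable; suff <- : C = bot V by [].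
apply/val_inj/fsetP => x; rewrite inE; apply/negP => /fC.
by rewrite /lit_false fnd_fmap0.
Qed.

Lemma maximal_unrefuted_consistent : consistent k F maximal_unrefuted.
Proof.
split.
  split=> [|phi [[]//]|phi [[_ uphi] _]]; first exact: exists_maximal_unrefuted.
  by apply/bot_in_apply => -[C /derivable_leaf/uphi].
move=> phi mphi v vF psi spsi npsi b.
exact: unrefuted_extend (maximal_unrefuted_set b mphi vF spsi npsi).
Qed.

End WidthToConsistent.

(** * Completeness of resolution and the equivalence *)

Lemma resolution_complete (V : choiceType) (F : clause_set V) :
  unsatisfiable F -> exists T, refutation F T.
Proof.
(* This [k] exceeds the size of every assignment over [var F], so a maximal [phi] may itself play
   the role of [psi]: any unset variable could still be set, hence [phi] is total. *)
move=> uF; apply: contrapT => noT; pose k := #|` var F|.+1.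
have nbot : ~ derivable F k (bot V).
  by move=> [T [rT lT eT _]]; apply: noT; exists T.
have [phi mphi] := exists_maximal_unrefuted nbot.
have [[dphi _] max] := mphi.
have [_ _ /(_ phi mphi)/negP] := (maximal_unrefuted_consistent nbot).1; apply.
apply: total_bot_in_apply => //; apply/fsubsetP => v vF; apply: contrapT => vd.
have vFd : v \in var F `\` domf phi by rewrite inE vF andbT; apply/negP.
apply: (max v true vFd); apply: maximal_unrefuted_set mphi vFd _ _ => //.
by rewrite ltnS fsubset_leq_card.
Qed.

(** Completeness ensures that [whd F] is a true minimum and not the dummy value. *)
Lemma whdP (V : choiceType) (F : clause_set V) (k : nat) : unsatisfiable F ->
  (k < whd F <-> forall T, refutation F T -> k < whd_tree T).
Proof.
move=> /resolution_complete[T0 rT0]; rewrite /whd; case: pselect => [ex|[]].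
  case: ex_minnP => m /asboolP[T rT eT] min; split=> [lt T' rT'|/(_ T rT)].
    by apply: leq_trans lt (min _ _); apply/asboolP; exists T'.
  by rewrite eT.
by exists (whd_tree T0); apply/asboolP; exists T0.
Qed.

Theorem theorem5p10 (V : choiceType) (F : clause_set V) (k : nat) :
  unsatisfiable F ->
  (k < whd F <-> exists P : set (passign V), consistent k F P).
Proof.
move=> uF; split=> [/(whdP k uF) lt|[P cP]].
  exists (maximal_unrefuted F k); apply: maximal_unrefuted_consistent.
  by move=> [T [rT lT eT]]; rewrite leqNgt lt.
by apply/(whdP k uF) => T; apply: (consistent_lt_whd_tree cP).
Qed.
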